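(* Let $G$ be a finite group of even order with a cyclic Sylow $2$-subgroup. Then $G$ is fully realizable if and only if $G$ is isomorphic to one of $\mathbf{C}_2$, $\mathbf{C}_6$, $\mathbf{C}_4$, $\mathbf{C}_{12}$.
   Context: Rings are associative with identity and ring homomorphisms preserve the identity. $R^\times$ is the group of units of a ring $R$; a ring endomorphism $\psi$ of $R$ restricts to a group endomorphism $\psi^\times$ of $R^\times$. A group $G$ is fully realizable if there is a ring $R$ with $R^\times = G$ (up to isomorphism) such that every group endomorphism of $G$ is of the form $\psi^\times$ for some ring endomorphism $\psi$ of $R$. $\mathbf{C}_m$ denotes the cyclic group of order $m$. *)

(* Defs.v *)
From HB Require Import structures.
From mathcomp Require Import all_boot all_order all_algebra.
From mathcomp Require Import all_fingroup all_solvable.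

Set Implicit Arguments.
Unset Strict Implicit.
Unset Printing Implicit Defensive.

Import GRing.Theory.
Local Open Scope ring_scope.

(* [GRing.unit] needs a [unitRingType], which excludes the zero ring and       *)
(* carries a decision procedure for invertibility, so the unit group of an     *)
(* arbitrary (possibly zero, possibly noncommutative) ring is built here. A    *)
(* unit is stored with its two-sided inverse; since inverses are unique,       *)
(* equality in [units R] is equality of the underlying ring elements           *)
(* (lemma [uval_inj]).                                                         *)
Definition mutual_inverses (R : pzRingType) (p : R * R) : bool :=
  (p.1 * p.2 == 1) && (p.2 * p.1 == 1).

Record units (R : pzRingType) := Units {
  upair : R * R;
  _ : mutual_inverses upair
}.

HB.instance Definition _ (R : pzRingType) := [isSub for @upair R].
HB.instance Definition _ (R : pzRingType) := [Choice of units R by <:].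

Definition uval (R : pzRingType) (u : units R) : R := (upair u).1.

Section UnitsGroup.
Variable R : pzRingType.
Implicit Types u v w : units R.

Lemma units_mulV u : (upair u).1 * (upair u).2 = 1.
Proof. by case: u => p /= /andP[/eqP]. Qed.

Lemma units_Vmul u : (upair u).2 * (upair u).1 = 1.
Proof. by case: u => p /= /andP[_ /eqP]. Qed.

Lemma uval_inj : injective (@uval R).
Proof.
move=> u v; rewrite /uval => uv1; apply: val_inj => /=.
rewrite [upair u]surjective_pairing [upair v]surjective_pairing uv1.
congr (_, _).
by rewrite -[LHS]mulr1 -(units_mulV v) mulrA -uv1 units_Vmul mul1r.
Qed.

Lemma uval_unitP (x : R) :
  (exists u, uval u = x) <-> exists y, x * y = 1 /\ y * x = 1.
Proof.
split=> [[u <-]|[y [xy yx]]].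
  by exists (upair u).2; split; [apply: units_mulV | apply: units_Vmul].
have xyP : mutual_inverses (x, y) by rewrite /mutual_inverses /= xy yx eqxx.
by exists (Units xyP).
Qed.

Fact units_one_subproof : mutual_inverses (1 : R, 1 : R).
Proof. by rewrite /mutual_inverses /= mulr1 eqxx. Qed.

Definition units_one : units R := Units units_one_subproof.

Fact units_mul_subproof u v :
  mutual_inverses ((upair u).1 * (upair v).1, (upair v).2 * (upair u).2).
Proof.
have cancel (a b c d : R) : b * c = 1 -> a * d = 1 -> (a * b) * (c * d) = 1.
  by move=> bc ad; rewrite mulrA -(mulrA a) bc mulr1.
apply/andP; split; apply/eqP => /=; apply: cancel;
  by rewrite ?units_mulV ?units_Vmul.
Qed.

Definition units_mul u v : units R := Units (units_mul_subproof u v).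

Fact units_inv_subproof u : mutual_inverses ((upair u).2, (upair u).1).
Proof. by rewrite /mutual_inverses /= units_mulV units_Vmul !eqxx. Qed.

Definition units_inv u : units R := Units (units_inv_subproof u).

Fact units_mulA : associative units_mul.
Proof. by move=> u v w; apply: uval_inj; apply: mulrA. Qed.

Fact units_mul1 : left_id units_one units_mul.
Proof. by move=> u; apply: uval_inj; apply: mul1r. Qed.

Fact units_1mul : right_id units_one units_mul.
Proof. by move=> u; apply: uval_inj; apply: mulr1. Qed.

Fact units_mulVu : left_inverse units_one units_inv units_mul.
Proof. by move=> u; apply: uval_inj; apply: units_Vmul. Qed.

Fact units_muluV : right_inverse units_one units_inv units_mul.
Proof. by move=> u; apply: uval_inj; apply: units_mulV. Qed.

HB.instance Definition _ := isGroup.Build (units R)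
  units_mulA units_mul1 units_1mul units_mulVu units_muluV.

Lemma uval1 : uval (1%g : units R) = 1. Proof. by []. Qed.

Lemma uvalM u v : uval (u * v)%g = uval u * uval v. Proof. by []. Qed.

End UnitsGroup.

Section UnitsMap.
Variables (R : pzRingType) (psi : {rmorphism R -> R}).

Fact units_map_subproof (u : units R) :
  mutual_inverses (psi (upair u).1, psi (upair u).2).
Proof. by rewrite /mutual_inverses /= -!rmorphM units_mulV units_Vmul rmorph1 eqxx. Qed.

Definition units_map (u : units R) : units R := Units (units_map_subproof u).

Lemma uval_map u : uval (units_map u) = psi (uval u). Proof. by []. Qed.

Fact units_mapM : {morph units_map : u v / (u * v)%g}.
Proof. by move=> u v; apply: uval_inj; apply: rmorphM. Qed.

HB.instance Definition _ :=
  isMultiplicative.Build (units R) (units R) units_map units_mapM.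

End UnitsMap.

Definition fully_realizable (G : groupType) : Prop :=
  exists (R : pzRingType) (e : {multiplicative G -> units R}),
    bijective e /\
    forall f : {multiplicative G -> G},
      exists psi : {rmorphism R -> R},
        forall x : G, e (f x) = units_map psi (e x).

(* Main.v *)
(* If R realizes G, lifting the trivial endomorphism gives -1 = 1, so R has
   characteristic 2, and R may be replaced by the finite span S of G.  Transfer
   into the cyclic Sylow 2-subgroup P gives a normal complement K of odd order;
   let psi lift the projection of G onto P.  An x in ker psi with x^2 = 0 would
   give an involution 1 + x in K, so ker psi is reduced.  Hence:
   - a commutator of units lies in ker psi, where it is killed by every primitive
     idempotent (the corner rings are finite fields), so G is abelian;
   - if z generates P, then n = 1 + z is nilpotent and annihilates ker psi; if
     its index m were at least 4, then 1 + n^(m-1) and 1 + n^(m-2) would be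
     distinct involutions of P; as n^(|P|/2) is nonzero, |P| <= 4;
   - lifting inversion forces g^3 = 1 on K;
   - if K had order larger than 3, it would contain a and b with a supported on a
     primitive idempotent e, and b supported on 1 - e, so that
     (1 + a)(1 + b) = 0; this relation is not preserved by a |-> ab, b |-> b.
   Conversely C_2 and C_4 are the unit groups of F_2[x]/(x^2) and F_2[x]/(x^3),
   and a factor F_4 adds the C_3. *)
From HB Require Import structures.
Require Import Defs.
From mathcomp Require Import all_boot all_order all_algebra.
From mathcomp Require Import all_fingroup all_solvable finfield.
Set Implicit Arguments.
Unset Strict Implicit.
Unset Printing Implicit Defensive.
Import GRing.Theory.

(** * Transfer into a cyclic Sylow 2-subgroup *)

Section Complement.
Local Open Scope group_scope.

(** [#[x ^+ i]] is [#[x]] divided by its gcd with [i], and for a nontrivial power of 2 that gcd is 1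
    exactly when [i] is odd. *)
Lemma odd_order_expg (gT : finGroupType) (x : gT) (i : nat) :
  2.-elt x -> x != 1 -> odd i = (#[x ^+ i] == #[x]).
Proof.
move=> p_x ntx.
have even_x : 2 %| #[x].
  have [[|k] ox] := p_natP p_x; last by rewrite ox expnS dvdn_mulr.
  by rewrite -order_eq1 ox in ntx.
rewrite orderXgcd; have [oddi | eveni] := boolP (odd i).
  suff /eqP-> : gcdn #[x] i == 1%N by rewrite divn1 eqxx.
  have [k ->] := p_natP p_x.
  by rewrite -/(coprime _ _) coprimeXl // coprime2n.
have: 2 %| gcdn #[x] i by rewrite dvdn_gcd even_x dvdn2.
move=> /dvdn_leq; rewrite gcdn_gt0 order_gt0 => /(_ isT) g2.
by rewrite ltn_eqF // ltn_Pdiv ?order_gt0.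
Qed.

(* The transfer V z is a product of G-conjugates in P of powers z ^ n_x, with
   \sum n_x = #|G : P| odd. In P the parity of an exponent is visible from the
   order, so V z is an odd power of z and 'ker V is the complement. *)
Lemma cyclic_Sylow2_complement (gT : finGroupType) (G P : {group gT}) :
  2.-Sylow(G) P -> cyclic P -> P :!=: 1 ->
  exists2 K : {group gT}, K ><| P = G & odd #|K|.
Proof.
move=> sylP /cyclicP[z defP] ntP; have [sPG pP p'GP] := and3P sylP.
have Pz : z \in P by rewrite defP cycle_id.
have p_z : 2.-elt z by rewrite /p_elt /order -defP.
have ntz : z != 1 by rewrite -cycle_eq1 -defP.
have abP : abelian (idm P @* P) by rewrite morphim_idm ?defP ?cycle_abelian.
pose V := transfer_morphism G abP.
have Gz := subsetP sPG z Pz.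
have Piz i : z ^+ i \in P by rewrite groupX.
have fmodz i : FiniteModule.fmod abP (z ^+ i) = (FiniteModule.fmod abP z *+ i)%R.
  by rewrite FiniteModule.fmodX //= morphim_idm.
have [i oddi Vz] : exists2 i, odd i & V z = (FiniteModule.fmod abP z *+ i)%R.
  have trX := transversalP (rcosets_cycle_partition sPG Gz).
  set X := transversal _ _ in trX.
  rewrite /= (transfer_cycle_expansion sPG abP Gz trX).
  have sumX := sum_index_rcosets_cycle sPG Gz trX.
  have odd_n : odd (\sum_(x in X) #|<[z]> : P :* x|)%N.
    by rewrite sumX odd_2'nat.
  have: forall x, x \in X -> exists2 i : nat,
      odd i = odd #|<[z]> : P :* x| & (z ^+ #|<[z]> : P :* x|) ^ x^-1 = z ^+ i.
    move=> x _; have := mulg_exp_card_rcosets P z x.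
    rewrite mem_rcoset -mulgA -{1}[x]invgK -conjgE defP => /cycleP[i def_i].
    exists i => //; rewrite [LHS](odd_order_expg _ p_z ntz) -def_i orderJ.
    by rewrite -(odd_order_expg _ p_z ntz) -defP.
  move=> conjX.
  suff [i oddi ->]: exists2 i, odd i = odd (\sum_(x in X) #|<[z]> : P :* x|)%N
      & (\sum_(x in X) restrm (transfer_morph_subproof (idm P))
           (FiniteModule.fmod abP \o idm P) ((z ^+ #|<[z]> : P :* x|) ^ x^-1)%g
         = FiniteModule.fmod abP z *+ i)%R.
    by exists i; rewrite ?oddi.
  elim/big_rec2: _ => [|x n1 u1 /conjX[i oddi zi] [j oddj ->]].
    by exists 0%N.
  exists (i + j)%N; first by rewrite !oddD oddi oddj.
  by rewrite zi GRing.mulrnDr -(fmodz i).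
have powz x : x \in P -> exists j, x = z ^+ j.
  by rewrite defP => /cycleP.
(* An odd power of [z] still generates [P], so [V] maps [P] bijectively onto its target. *)
have gen_i : <[z ^+ i]> = <[z]>.
  apply/eqP; rewrite eqEcard cycle_subG groupX ?cycle_id //=.
  by rewrite -!/(order _) leq_eqVlt eq_sym -odd_order_expg ?oddi.
have VX j : V (z ^+ j) = FiniteModule.fmod abP ((z ^+ i) ^+ j).
  rewrite morphX //= [transfer _ _ _]Vz -fmodz.
  by apply/esym/FiniteModule.fmodX; rewrite /= morphim_idm.
have fmod_inj : {in P &, injective (FiniteModule.fmod abP)}.
  move=> x y Px Py; apply: (injmP (FiniteModule.injm_fmod abP));
    by rewrite /= morphim_idm.
have tiKP : 'ker V :&: P = 1.
  apply/trivgP/subsetP=> x /setIP[/morphpreP[Gx /set1P Vx] /powz[j def_x]].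
  rewrite def_x VX in Vx.
  have /eqP: (z ^+ i) ^+ j = 1.
    by apply: fmod_inj; rewrite ?groupX ?group1 // Vx FiniteModule.fmod1.
  rewrite -order_dvdn [#[_]]/order gen_i -[#|_|]/(#[z]) order_dvdn.
  by rewrite inE def_x.
have defG : 'ker V ><| P = G.
  rewrite sdprodE // ?(subset_trans sPG) ?normal_norm ?ker_normal //.
  apply/eqP; rewrite eqEsubset; apply/andP; split.
    by apply: mul_subG => //; apply/normal_sub/ker_normal.
  apply/subsetP=> x Gx.
  have [j Vx] : exists j, FiniteModule.fmval (V x) = (z ^+ i) ^+ j.
    have imP : {subset idm P @* P <= P} by move=> y; rewrite morphim_idm.
    by apply/cycleP; rewrite gen_i -defP; apply/imP/(valP (V x)).
  (* [x] and [z ^+ j] have the same transfer, so their quotient lies in the kernel. *)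
  rewrite -[x](mulgKV (z ^+ j)) mem_mulg ?Piz //.
  apply/kerP; rewrite ?groupM ?groupV ?groupX //.
  rewrite morphM ?morphV ?groupV ?groupX // VX -Vx FiniteModule.fmvalK.
  exact: mulgV.
exists ('ker V)%G; first exact: defG.
suff -> : #|'ker V| = #|G : P| by rewrite odd_2'nat.
apply/eqP; rewrite -(eqn_pmul2l (cardG_gt0 P)) (Lagrange sPG) mulnC.
by rewrite (sdprod_card defG).
Qed.
End Complement.

(** * Realizations by a ring, and reduction to a finite one *)

Local Open Scope ring_scope.

(** Units appear as ring elements instead of inverse pairs, so that later arguments compute directly
    in [R]. *)
Record realization (gT : finGroupType) (R : pzRingType) (E : gT -> R) : Prop :=
  Realization {
  real1 : E 1%g = 1;
  realM : {morph E : g h / (g * h)%g >-> g * h};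
  real_inj : injective E;
  real_unit : forall x y, x * y = 1 -> y * x = 1 -> exists g, x = E g;
  real_lift : forall f : {multiplicative gT -> gT},
    exists psi : {rmorphism R -> R}, forall g, psi (E g) = E (f g)
}.

Lemma fully_realizableP (gT : finGroupType) :
  fully_realizable gT <->
  exists (R : pzRingType) (E : gT -> R), realization E.
Proof.
split=> [[R [e [[e' eK e'K] lift]]] | [R [E [E1 EM Einj Eunit lift]]]].
  have e1 : e 1%g = 1%g.
    by apply: (mulgI (e 1%g)); rewrite -gmulfM !mulg1.
  exists R, (fun g => uval (e g)); split.
  - by rewrite e1.
  - by move=> g h; rewrite gmulfM.
  - by move=> g h /uval_inj/(can_inj eK).
  - move=> x y xy yx; have [u <-] : exists u, uval u = x.
      by apply/uval_unitP; exists y.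
    by exists (e' u); rewrite e'K.
  - by move=> f; have [psi psiE] := lift f; exists psi => g; rewrite psiE.
have EV g : mutual_inverses (E g, E g^-1%g).
  by rewrite /mutual_inverses /= -!EM mulgV mulVg E1 eqxx.
pose e g : units R := Units (EV g).
have eM : {morph e : g h / (g * h)%g}.
  by move=> g h; apply: uval_inj; apply: EM.
pose e_mul := isMultiplicative.Build gT (units R) e eM.
pose eH : {multiplicative gT -> units R} := HB.pack e e_mul.
exists R, eH; split; last first.
  move=> f; have [psi psiE] := lift f; exists psi => g; apply: uval_inj.
  exact/esym/psiE.
(* The default is never taken: [Eunit] provides a preimage of every unit. *)
pose e' u := odflt 1%g [pick g | e g == u].
have e_inj : injective e by move=> g h /(congr1 (@uval R)) /Einj.
have e'K u : e (e' u) = u.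
  have [g ug] : exists g, uval u = E g.
    by apply: (Eunit _ (upair u).2); rewrite /uval ?units_mulV ?units_Vmul.
  rewrite /e'; case: pickP => [h /eqP //|/(_ g)/eqP[]].
  exact: uval_inj.
by exists e' => [g | u]; [apply: e_inj; apply: (e'K (e g)) | apply: e'K].
Qed.

Section FiniteSpan.

Variables (gT : finGroupType) (R : pzRingType) (E : gT -> R).
Hypothesis realE : realization E.

Lemma real_lift_fun (f : gT -> gT) :
  {morph f : g h / (g * h)%g} ->
  exists psi : {rmorphism R -> R}, forall g, psi (E g) = E (f g).
Proof.
move=> fM; pose f_mul := isMultiplicative.Build gT gT f fM.
exact: (real_lift realE (HB.pack f f_mul)).
Qed.

(** The unit [-1] is some [E g]; the lift of the trivial endomorphism sends it to 1, while every
    ring morphism fixes it. *)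
Lemma real_char2 (x : R) : x + x = 0.
Proof.
have [||g def_g] := real_unit realE (x := -1) (y := -1); rewrite ?mulrNN ?mulr1 //.
have [|psi psiE] := real_lift_fun (f := fun=> 1%g); first by move=> *; rewrite mulg1.
have: psi (-1) = 1 by rewrite def_g psiE (real1 realE).
rewrite rmorphN1 => N11.
by rewrite -{2}[x]mul1r -[in X in X * x]N11 mulN1r subrr.
Qed.

Lemma sum_setsD (A B : {set gT}) :
  \sum_(g in A) E g + \sum_(g in B) E g =
  \sum_(g in [set g | (g \in A) (+) (g \in B)]) E g.
Proof.
rewrite !(big_mkcond (fun g => g \in _)) -big_split /=.
apply: eq_bigr => g _; rewrite inE.
by case: (g \in A); case: (g \in B); rewrite /= ?add0r ?addr0 ?real_char2.
Qed.

(** Subsets of [gT] serve as coefficient vectors over F_2, which makes the span finite. *)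
Definition span_pred : {pred R} :=
  fun x => [exists A : {set gT}, x == \sum_(g in A) E g].

Lemma span_predP x :
  reflect (exists A : {set gT}, x = \sum_(g in A) E g) (x \in span_pred).
Proof. by apply: (iffP existsP) => -[A def_x]; exists A; apply/eqP. Qed.

Lemma span_pred_E g : E g \in span_pred.
Proof. by apply/span_predP; exists [set g]; rewrite big_set1. Qed.

Fact span_predD : {in span_pred &, forall x y, x + y \in span_pred}.
Proof.
move=> _ _ /span_predP[A ->] /span_predP[B ->].
by apply/span_predP; eexists; apply: sum_setsD.
Qed.

Fact span_sum (A : {set gT}) (F : gT -> R) :
  (forall g, F g \in span_pred) -> \sum_(g in A) F g \in span_pred.
Proof.
move=> FP; elim/big_ind: _ => // [|x y]; last exact: span_predD.
by apply/span_predP; exists set0; rewrite big_set0.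
Qed.

Fact span_subring : subring_closed span_pred.
Proof.
have opp (x : R) : - x = x by apply/eqP; rewrite eq_sym -addr_eq0 real_char2.
split; first by rewrite -(real1 realE) span_pred_E.
  by move=> x y Sx Sy; rewrite opp span_predD.
move=> _ _ /span_predP[A ->] /span_predP[B ->].
rewrite mulr_suml span_sum // => g; rewrite mulr_sumr span_sum // => h.
by rewrite -(realM realE) span_pred_E.
Qed.

Record span_ring := SpanRing { span_val :> R; _ : span_val \in span_pred }.
HB.instance Definition _ := [isSub for span_val].
HB.instance Definition _ := [Choice of span_ring by <:].
HB.instance Definition _ :=
  GRing.SubChoice_isSubPzRing.Build R span_pred span_ring span_subring.

Let of_set (A : {set gT}) : option span_ring := insub (\sum_(g in A) E g).
Let to_set (x : span_ring) : {set gT} :=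
  odflt set0 [pick A : {set gT} | val x == \sum_(g in A) E g].
Fact span_ring_pcan : pcancel to_set of_set.
Proof.
move=> x; rewrite /to_set /of_set; case: pickP => [A /eqP <- | no_A] /=.
  exact: valK.
by have /span_predP[A def_x] := valP x; have /eqP[] := no_A A.
Qed.
HB.instance Definition _ : isCountable span_ring := PCanIsCountable span_ring_pcan.
HB.instance Definition _ : isFinite span_ring := PCanIsFinite span_ring_pcan.

(** A unit of the span is a unit of [R], hence some [E g]; a lift maps each [E g] to some [E h], so
    it preserves the span. *)
Lemma finite_realization :
  exists (S : finPzRingType) (E' : gT -> S), realization E'.
Proof.
pose E' g := SpanRing (span_pred_E g).
exists span_ring, E'; split.
- by apply: val_inj; apply: (real1 realE).
- by move=> g h; apply: val_inj; apply: (realM realE).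
- by move=> g h /(congr1 val) /(real_inj realE).
- move=> x y /(congr1 val) xy /(congr1 val) yx.
  have [g def_x] := real_unit realE xy yx.
  by exists g; apply: val_inj.
move=> f; have [psi psiE] := real_lift realE f.
have psiS (x : span_ring) : psi (val x) \in span_pred.
  have /span_predP[A ->] := valP x; rewrite rmorph_sum.
  by apply: span_sum => g; rewrite psiE span_pred_E.
pose phi x := SpanRing (psiS x).
have phiB : zmod_morphism phi by move=> x y; apply: val_inj; apply: rmorphB.
have phiM : monoid_morphism phi.
  by split=> [|x y]; apply: val_inj; [apply: rmorph1 | apply: rmorphM].
pose phi_zmod := GRing.isZmodMorphism.Build span_ring span_ring phi phiB.
pose phi_mon := GRing.isMonoidMorphism.Build span_ring span_ring phi phiM.
pose phiH : {rmorphism span_ring -> span_ring} := HB.pack phi phi_zmod phi_mon.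
by exists phiH => g; apply: val_inj; apply: psiE.
Qed.

End FiniteSpan.

(** * Idempotents of a finite ring and corners of a reduced kernel *)

Lemma exists_idempotent_power (S : finPzRingType) (x : S) :
  exists2 m, (0 < m)%N & x ^+ m * x ^+ m = x ^+ m.
Proof.
have [i [d [d_gt0 xid]]] : exists i d, (0 < d)%N /\ x ^+ (i + d) = x ^+ i.
  pose f (i : 'I_#|S|.+1) := x ^+ i.
  have /injectivePn[i [j neq_ij fij]] : ~~ injectiveb f.
    by apply/injectiveP => /leq_card; rewrite card_ord ltnn.
  wlog lt_ij : i j neq_ij fij / (i < j)%N.
    move=> IH; have [/IH|/IH|/val_inj/eqP] := ltngtP i j; first exact.
      by apply; rewrite // eq_sym.
    by rewrite (negPf neq_ij).
  by exists i, (j - i)%N; rewrite subn_gt0 lt_ij subnKC 1?ltnW.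
have xkd q k : (i <= k)%N -> x ^+ (k + d * q) = x ^+ k.
  elim: q k => [|q IHq] k le_ik; first by rewrite muln0 addn0.
  rewrite mulnS addnA IHq ?(leq_trans le_ik) ?leq_addr //.
  by rewrite -(subnKC le_ik) -addnA [(k - i + d)%N]addnC addnA exprD xid -exprD.
(* This exponent is a multiple of the period [d] and at least the preperiod [i], so doubling it does
   not change the power. *)
exists (d * i.+1)%N; first by rewrite muln_gt0 d_gt0.
by rewrite -exprD xkd // (leq_trans (leqnSn i)) // leq_pmull.
Qed.

Section ReducedKernel.

Variables (S : finPzRingType) (psi : {rmorphism S -> S}).
Hypothesis kerN : forall x, psi x = 0 -> x * x = 0 -> x = 0.

Lemma kerN_exp x m : psi x = 0 -> x ^+ m = 0 -> x = 0.
Proof.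
move=> Ix xm0; have: x ^+ (2 ^ m) = 0.
  by rewrite -(subnKC (ltnW (ltn_expl m (ltnSn 1)))) exprD xm0 mul0r.
elim: m {xm0} => // m IHm; rewrite expnSr exprM expr2 => /kerN; rewrite rmorphXn Ix /=.
by rewrite expr0n expn_eq0 => /(_ erefl)/IHm.
Qed.

(** Both [e * x * e - e * x] and [e * x * e - x * e] lie in the kernel and have square zero. *)
Lemma ker_idem_central e x : psi e = 0 -> e * e = e -> e * x = x * e.
Proof.
move=> Ie ee.
have exe : e * x * e = e * x.
  apply/eqP; rewrite -subr_eq0; apply/eqP/kerN.
    by rewrite rmorphB !rmorphM Ie !mul0r subrr.
  by rewrite mulrBr !mulrBl -!mulrA !(mulrA e e) !ee !subrr ?subr0.
have <- : e * x * e = x * e.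
  apply/eqP; rewrite -subr_eq0; apply/eqP/kerN.
    by rewrite rmorphB !rmorphM Ie !mulr0 subrr.
  by rewrite mulrBr !mulrBl -!mulrA !(mulrA e e) !ee !subrr ?subr0.
by rewrite exe.
Qed.

(** If [e = x ^+ m] is idempotent, then [x * (1 - e)] is in the kernel and its [m]-th power is
    [e * (1 - e) = 0]. *)
Lemma ker_idem_exp x : psi x = 0 -> exists m,
  [/\ (0 < m)%N, x ^+ m * x ^+ m = x ^+ m & x * x ^+ m = x].
Proof.
move=> Ix; have [m m_gt0 idem] := exists_idempotent_power x.
exists m; split=> //; apply/eqP; rewrite eq_sym -subr_eq0; apply/eqP.
apply: (@kerN_exp _ m); first by rewrite rmorphB rmorphM Ix mul0r subrr.
rewrite -[X in (X - _) ^+ _]mulr1 -mulrBr exprMn_comm; last first.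
  by apply: commrB; [apply: commr1 | apply: commrX].
have -> : (1 - x ^+ m) ^+ m = 1 - x ^+ m.
  case: m m_gt0 idem => // m _; move: (x ^+ m.+1) => y yy.
  elim: m => [|n IHn]; first by rewrite expr1.
  by rewrite exprS IHn mulrBr mulr1 mulrBl mul1r yy subrr subr0.
by rewrite mulrBr mulr1 idem subrr.
Qed.

Definition primitive_idem e := [/\ psi e = 0, e != 0, e * e = e
  & forall f, f * f = f -> f * e = f -> f = 0 \/ f = e].

(** Among the nonzero kernel idempotents below [x ^+ m], one whose ideal [e * S] (the [y] with
    [e * y = y]) has least size is primitive. *)
Lemma exists_primitive_idem x : psi x = 0 -> x != 0 ->
  exists2 e, primitive_idem e & e * x != 0.
Proof.
move=> Ix nz_x; have [m [m_gt0 idem xm]] := ker_idem_exp Ix.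
pose P e := [&& psi e == 0, e != 0, e * e == e & e * x ^+ m == e].
have Pxm : P (x ^+ m).
  rewrite /P rmorphXn Ix expr0n eqn0Ngt m_gt0 idem !eqxx !andbT /=.
  by apply: contraNneq nz_x => xm0; rewrite -xm xm0 mulr0.
case: (arg_minnP (fun e => #|[set y | e * y == y]|) Pxm) => e.
move=> /and4P[/eqP Ie nz_e /eqP ee /eqP exm] min_e.
exists e; last first.
  apply: contraNneq nz_e => ex; rewrite -exm.
  by case: m m_gt0 {idem xm P Pxm min_e exm} => // m _; rewrite exprS mulrA ex mul0r.
split=> // f ff fe; have [-> | nz_f] := eqVneq f 0; [by left | right].
have If : psi f = 0 by rewrite -fe rmorphM Ie mulr0.
have /min_e : P f.
  by rewrite /P If nz_f ff !eqxx -{1}fe -mulrA exm fe eqxx.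
move=> le_ef.
have sub_fe : [set y | f * y == y] \subset [set y | e * y == y].
  apply/subsetP=> y; rewrite !inE => /eqP <-.
  by rewrite mulrA (ker_idem_central f Ie ee) fe.
have /setP/(_ e) : [set y | f * y == y] = [set y | e * y == y].
  by apply/eqP; rewrite eqEcard sub_fe.
by rewrite !inE fe ee eqxx => /eqP.
Qed.

Section Corner.

Variable e : S.
Hypothesis prim_e : primitive_idem e.

Let Ie : psi e = 0. Proof. by have [] := prim_e. Qed.
Let nz_e : e != 0. Proof. by have [] := prim_e. Qed.
Let ee : e * e = e. Proof. by have [] := prim_e. Qed.
Let min_e f : f * f = f -> f * e = f -> f = 0 \/ f = e.
Proof. by have [_ _ _] := prim_e; apply. Qed.
Let ceS x : e * x = x * e. Proof. exact: ker_idem_central. Qed.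

(** An idempotent power of [e * x] lies below [e]: if it is 0 then so is [e * x], and if it is [e]
    then [e * x] is invertible in the corner. *)
Lemma corner_domain x y : e * x * y = 0 -> e * x = 0 \/ e * y = 0.
Proof.
move=> exy; have Iex : psi (e * x) = 0 by rewrite rmorphM Ie mul0r.
have [m [m_gt0 idem exm]] := ker_idem_exp Iex.
have [|xm0|xme] := min_e idem.
- by rewrite -ceS; case: m m_gt0 {idem exm} => // m _; rewrite exprS !mulrA ee.
- by left; rewrite -exm xm0 mulr0.
right; rewrite -xme; case: m m_gt0 {idem exm xme} => // m _.
by rewrite exprSr -mulrA exy mulr0.
Qed.

Definition corner_pred : {pred S} := fun x => e * x == x.
Fact corner_zmod : zmod_closed corner_pred.
Proof.
split=> [|x y]; rewrite !unfold_in /corner_pred ?mulr0 //.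
by move=> /eqP ex /eqP ey; rewrite mulrBr ex ey.
Qed.

(** The ring [e * S] with identity [e], made a finite ring type so that Wedderburn's theorem
    [finDomain_mulrC] applies. *)
Record corner := Corner { corner_val :> S; _ : corner_val \in corner_pred }.
HB.instance Definition _ := [isSub for corner_val].
HB.instance Definition _ := [Finite of corner by <:].
HB.instance Definition _ :=
  GRing.SubChoice_isSubZmodule.Build S corner_pred corner corner_zmod.

Fact corner_one_subproof : e \in corner_pred. Proof. by apply/eqP. Qed.
Fact corner_mul_subproof (x y : corner) : val x * val y \in corner_pred.
Proof. by apply/eqP; rewrite mulrA (eqP (valP x)). Qed.
Let one := Corner corner_one_subproof.
Let mul x y := Corner (corner_mul_subproof x y).
Fact corner_mulA : associative mul.
Proof. by move=> x y z; apply: val_inj; apply: mulrA. Qed.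
Fact corner_mul1 : left_id one mul.
Proof. by move=> x; apply: val_inj; apply/eqP/(valP x). Qed.
Fact corner_1mul : right_id one mul.
Proof. by move=> x; apply: val_inj; rewrite /= -ceS; apply/eqP/(valP x). Qed.
Fact corner_mulDl : left_distributive mul +%R.
Proof. by move=> x y z; apply: val_inj; apply: mulrDl. Qed.
Fact corner_mulDr : right_distributive mul +%R.
Proof. by move=> x y z; apply: val_inj; apply: mulrDr. Qed.
Fact corner_1neq0 : one != 0. Proof. exact: nz_e. Qed.
HB.instance Definition _ := GRing.Zmodule_isNzRing.Build corner
  corner_mulA corner_mul1 corner_1mul corner_mulDl corner_mulDr corner_1neq0.
HB.instance Definition _ := FinRing.isNzRing.Build corner.

Lemma corner_commutative x y : e * (x * y) = e * (y * x).
Proof.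
have cornerP z : e * z \in corner_pred by apply/eqP; rewrite mulrA ee.
have dom : GRing.integral_domain_axiom corner.
  move=> [u eu] [v ev] /(congr1 val) /= uv.
  have := corner_domain (x := u) (y := v).
  rewrite (eqP eu) (eqP ev) => /(_ uv).
  by case=> z; apply/orP; [left | right]; apply/eqP/val_inj.
have /(congr1 val) /= :=
  finDomain_mulrC dom (Corner (cornerP x)) (Corner (cornerP y)).
by rewrite !mulrA -!(ceS (e * _)) !mulrA ee.
Qed.

End Corner.

Lemma ker_commutator x y : psi (x * y - y * x) = 0 -> x * y = y * x.
Proof.
move=> Ixy; apply/eqP; rewrite -subr_eq0; apply: contraT.
case/(exists_primitive_idem Ixy) => e prim_e.
by rewrite mulrBr (corner_commutative prim_e) subrr eqxx.
Qed.

End ReducedKernel.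

(** * Structure of a group with a finite realization *)

Section FiniteRealization.

Variables (gT : finGroupType) (S : finPzRingType) (E : gT -> S).
Hypothesis realE : realization E.
Variables (K P : {group gT}).
Hypotheses (defG : (K ><| P)%g = [set: gT]) (oddK : odd #|K|).
Hypotheses (pP : (2.-group P)%g) (cycP : cyclic P).

Let EM g h : E (g * h)%g = E g * E h. Proof. exact: (realM realE). Qed.
Let E1 : E 1%g = 1. Proof. exact: (real1 realE). Qed.
Let Einj : injective E. Proof. exact: (real_inj realE). Qed.
Let addxx (x : S) : x + x = 0. Proof. exact: (real_char2 realE). Qed.
Let oppx (x : S) : - x = x. Proof. by apply/eqP; rewrite eq_sym -addr_eq0 addxx. Qed.
Let addK (x y : S) : x + (x + y) = y. Proof. by rewrite addrA addxx add0r. Qed.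
Let add_eq0 (x y : S) : x + y = 0 -> x = y.
Proof. by move/eqP; rewrite addr_eq0 oppx => /eqP. Qed.

Let EX g i : E (g ^+ i)%g = E g ^+ i.
Proof. by elim: i => [|i IHi]; rewrite ?E1 // expgS exprS EM IHi. Qed.

(** Frobenius in characteristic 2, valid in a noncommutative ring because 1 commutes with [x]. *)
Lemma add1_expr2 (x : S) k : (1 + x) ^+ (2 ^ k) = 1 + x ^+ (2 ^ k).
Proof.
elim: k => [|k IHk]; rewrite ?expr1 // expnSr !exprM IHk.
rewrite expr2 mulrDl mul1r mulrDr mulr1.
by rewrite addrA -(addrA 1) addxx addr0 expr2.
Qed.

Let proj := remgr K P.
Let projM : {morph proj : g h / (g * h)%g}.
Proof.
have [nKG _ _ _ _] := sdprod_context defG.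
by move=> g h; apply: (remgrM (sdprod_compl defG) nKG); rewrite inE.
Qed.
Let proj_P g : proj g \in P.
Proof. by apply: mem_remgr; rewrite (sdprodW defG) inE. Qed.
Let proj_id g : g \in P -> proj g = g.
Proof. by have [_ _ _ _ tiKP] := sdprod_context defG; apply: remgr_id. Qed.
Let proj_K g : g \in K -> proj g = 1%g.
Proof. by have [_ _ _ _ tiKP] := sdprod_context defG; apply: remgr1. Qed.
Let proj1_K g : proj g = 1%g -> g \in K.
Proof.
move=> pg1; rewrite (divgr_eq K P g) [remgr K P g]pg1 mulg1.
by apply: mem_divgr; rewrite (sdprodW defG) inE.
Qed.

Variable psi : {rmorphism S -> S}.
Hypothesis psiE : forall g, psi (E g) = E (proj g).

Lemma psi_kerN x : psi x = 0 -> x * x = 0 -> x = 0.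
Proof.
move=> Ix xx; have u2 : (1 + x) * (1 + x) = 1.
  by rewrite -expr2 -[2%N]/(2 ^ 1)%N add1_expr2 expr2 xx addr0.
have [g def_u] := real_unit realE u2 u2.
have Kg : g \in K.
  by apply/proj1_K/Einj; rewrite -psiE -def_u rmorphD rmorph1 Ix addr0 E1.
have /eqP : (g ^+ 2)%g = 1%g by apply: Einj; rewrite EX -def_u expr2 u2 E1.
rewrite -order_dvdn => dvd_g2; have := dvdn_gcd #[g]%g 2 #|K|.
rewrite dvd_g2 order_dvdG // (eqP (_ : coprime 2 #|K|)) ?coprime2n // dvdn1 order_eq1.
move=> /eqP g1; move: def_u; rewrite g1 E1 => /(congr1 (+%R 1)).
by rewrite addK addxx.
Qed.

Lemma real_commute g h : E g * E h = E h * E g.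
Proof.
apply: (ker_commutator psi_kerN); rewrite rmorphB !rmorphM !psiE -!EM.
have /centsP cPP := cyclic_abelian cycP.
by rewrite (cPP _ (proj_P g) _ (proj_P h)) subrr.
Qed.

Lemma real_abelian (g h : gT) : (g * h = h * g)%g.
Proof. by apply: Einj; rewrite !EM real_commute. Qed.

(* If n^2 annihilates the kernel, then (n x n)^2 = 0, so n x n = 0 and then
   (n x)^2 = 0: reducedness halves the exponent. *)
Lemma nil_annihilates k n :
    (forall x, psi x = 0 -> n ^+ (2 ^ k) * x = 0) ->
  forall x, psi x = 0 -> n * x = 0.
Proof.
elim: k n => [|k IHk] n nI //.
have n2I x : psi x = 0 -> n * n * x = 0.
  by rewrite -expr2; apply: IHk => {}x /nI; rewrite expnS exprM.
move=> x Ix; have nxn : n * x * n = 0.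
  apply: psi_kerN; first by rewrite !rmorphM Ix mulr0 mul0r.
  by rewrite -!mulrA (mulrA n n) n2I ?mulr0 // rmorphM Ix mul0r.
apply: psi_kerN; first by rewrite rmorphM Ix mulr0.
by rewrite mulrA nxn mul0r.
Qed.

Let nil_z z : z \in P -> exists k, (1 + E z) ^+ (2 ^ k) = 0.
Proof.
move=> Pz; have [k oz] := p_natP (mem_p_elt pP Pz); exists k.
by rewrite add1_expr2 -EX -oz expg_order E1 addxx.
Qed.

(** [1 + E z] is nilpotent because the order of [z] is a power of 2, so it annihilates the
    kernel. *)
Lemma Sylow_fixes_ker z x : z \in P -> psi x = 0 -> E z * x = x.
Proof.
move=> Pz Ix; have [k nk] := nil_z Pz; apply: add_eq0.
rewrite addrC -{1}[x]mul1r -mulrDl; apply: (nil_annihilates (k := k)) Ix => y _.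
by rewrite nk mul0r.
Qed.

Lemma card_Sylow_le4 : (#|P| <= 4)%N.
Proof.
have /cyclicP[z defP] := cycP; have Pz : z \in P by rewrite defP cycle_id.
rewrite defP -[#|_|]/#[z]%g; have [k oz] := p_natP (mem_p_elt pP Pz).
rewrite leqNgt; apply/negP=> gt4; case: k oz => [|k] oz; first by rewrite oz in gt4.
pose n := 1 + E z; have psi_n : psi n = n.
  by rewrite rmorphD rmorph1 psiE proj_id.
have [k' nk'] := nil_z Pz.
have [m /eqP nm min_m] := ex_minnP (ex_intro (fun m => n ^+ m == 0) _ (introT eqP nk')).
(* Here [#[z]] is [2 ^ k.+1], so [n ^+ (2 ^ k) = 1 + E (z ^+ (2 ^ k))] is nonzero. *)
have m_gt4 : (4 <= 2 ^ k < m)%N.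
  rewrite oz -[4%N]/(2 ^ 2)%N ltn_exp2l // ltnS in gt4.
  rewrite -{1}[4%N]/(2 ^ 2)%N leq_exp2l // gt4 ltnNge; apply/negP=> le_mk.
  have: n ^+ (2 ^ k) == 0 by rewrite -(subnKC le_mk) exprD nm mul0r.
  rewrite add1_expr2 -EX => /eqP /add_eq0; rewrite -E1 => /Einj/esym/eqP.
  by rewrite -order_dvdn oz dvdn_Pexp2l // ltnn.
(* The square of [n ^+ a] vanishes once [m <= a + a], and [psi] fixes [n], which places the
   involution [1 + n ^+ a] in [P]. *)
have invol a : (2 <= a)%N -> (a < m)%N -> (m <= a + a)%N ->
    exists2 g, E g = 1 + n ^+ a & #[g]%g = 2 /\ g \in P.
  move=> a_ge2 lt_am le_ma; pose u := 1 + n ^+ a.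
  have u2 : u * u = 1.
    rewrite -expr2 -[2%N]/(2 ^ 1)%N add1_expr2 expr2 -exprD.
    by rewrite -(subnKC le_ma) exprD nm mul0r addr0.
  have [g def_g] := real_unit realE u2 u2; exists g => //.
  have /eqP : (g ^+ 2)%g = 1%g by apply: Einj; rewrite EX -def_g expr2 u2 E1.
  move=> /eqP g2; split.
    apply: nt_prime_order => //; apply: contraTneq lt_am => g1.
    rewrite -leqNgt; apply: min_m; apply/eqP; rewrite -[RHS](addxx 1).
    by rewrite -{2}E1 -g1 -def_g addK.
  suff -> : g = proj g by apply: proj_P.
  by apply: Einj; rewrite -psiE -def_g rmorphD rmorph1 rmorphXn /= psi_n.
have{k oz gt4 m_gt4} [a def_m a_gt0] : exists2 a, m = a.+2 & (1 < a)%N.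
  case/andP: m_gt4 => k4 /(leq_ltn_trans k4).
  by case: (m) => [|[|a]] // lt4a; exists a => //; apply: ltnW.
have [|||g Eg [og Pg]] := invol a; rewrite ?def_m //.
  by rewrite -addn2 leq_add2l.
have [|||h Eh [oh Ph]] := invol a.+1; rewrite ?def_m ?(leqW a_gt0) //.
  by rewrite addnS ltnS addSn ltnS leq_addr.
(* A cyclic group has at most one subgroup of order 2, so the involutions for the exponents [a] and
   [a.+1] coincide. *)
have /eqP : <[g]>%g == <[h]>%g :> {set gT}.
  by rewrite (eq_subG_cyclic cycP) ?cycle_subG // -!/(#[_]%g) og oh.
move/setP/(_ h); rewrite cycle_id (cycle2g og) !inE => /orP[/eqP h1 | /eqP hg].
  by rewrite h1 order1 in oh.
have: n ^+ a.+1 == 0.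
  apply/eqP; have : n ^+ a = n ^+ a.+1.
    by rewrite -[LHS](addK 1) -Eg -hg Eh addK.
  by move/(congr1 ( *%R n)); rewrite -!exprS -def_m nm.
by move/min_m; rewrite def_m ltnn.
Qed.

Let psi1 g : g \in K -> psi (1 + E g) = 0.
Proof. by move=> Kg; rewrite rmorphD rmorph1 psiE proj_K // E1 addxx. Qed.

(* With t = 1 + g and the idempotent e = t^m, the element u = t + (1 - e) is a
   unit; the lift iota of inversion fixes e and maps t to g^-1 t, so u iota(u) = 1
   reads g^-1 t^2 = e, whence t^3 = g t, that is 1 + g^3 = 0. *)
Lemma real_cube g : g \in K -> (g ^+ 3 = 1)%g.
Proof.
move=> Kg; have [t def_t] : {t | t = 1 + E g} by exists (1 + E g).
have It : psi t = 0 by rewrite def_t psi1.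
have [m [m_gt0 ee te]] := ker_idem_exp psi_kerN It.
set e := t ^+ m in ee te.
have Ie : psi e = 0 by rewrite rmorphXn /= It expr0n eqn0Ngt m_gt0.
have eC x : e * x = x * e by apply: (ker_idem_central psi_kerN x Ie ee).
have [iota iotaE] : exists iota : {rmorphism S -> S}, forall h, iota (E h) = E h^-1%g.
  by apply: (real_lift_fun realE) => x y; rewrite invMg real_abelian.
pose w := E g^-1%g; have wg : w * E g = 1 by rewrite -EM mulVg E1.
have gw : E g * w = 1 by rewrite -EM mulgV E1.
have iota_t : iota t = w * t.
  by rewrite def_t rmorphD rmorph1 iotaE mulrDr wg mulr1 addrC.
have wt : GRing.comm w t.
  by rewrite def_t; apply: commrD; [apply: commr1 | apply: real_commute].
(* [iota e = w ^+ m * e] and [e = E g ^+ m * iota e], so these two idempotents lie below each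
   other. *)
have iota_e : iota e = e.
  have def_ie : iota e = w ^+ m * e by rewrite rmorphXn /= iota_t exprMn_comm.
  have iee : iota e * e = iota e by rewrite def_ie -mulrA ee.
  have gie : E g ^+ m * iota e = e.
    rewrite def_ie mulrA -exprMn_comm; last exact: real_commute.
    by rewrite gw expr1n mul1r.
  by rewrite -iee -eC -{1}gie -mulrA -rmorphM ee gie.
(* [c] is the complementary idempotent [1 - e], written [1 + e] in characteristic 2. *)
have [c [[ec tc xec] cc cC iota_c]] : exists c, [/\ [/\ e + c = 1, t * c = 0 &
    forall x, x * e * c = 0], c * c = c, forall x, c * x = x * c & iota c = c].
  exists (1 + e); split; [split=> [||x] | | move=> x |].
  - by rewrite addrCA addxx addr0.
  - by rewrite mulrDr mulr1 te addxx.
  - by rewrite -mulrA mulrDr mulr1 ee addxx mulr0.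
  - by rewrite mulrDr mulr1 mulrDl mul1r ee addxx addr0.
  - by rewrite mulrDl mulrDr eC mul1r mulr1.
  - by rewrite rmorphD rmorph1 iota_e.
(* In the corner of [e] the inverse of [t] is [t ^+ m.-1 * e]; adding [c] extends it to all of
   [S]. *)
have [h def_u] : exists h, t + c = E h.
  have tv : t * (t ^+ m.-1 * e) = e by rewrite mulrA -exprS prednK // ee.
  have vt : t ^+ m.-1 * e * t = e by rewrite -mulrA eC mulrA -exprSr prednK // ee.
  apply: (real_unit realE (y := t ^+ m.-1 * e + c)).
    by rewrite mulrDl !mulrDr tv tc cC xec cc addr0 add0r.
  by rewrite mulrDl !mulrDr vt xec cC tc cc addr0 add0r.
have: (t + c) * iota (t + c) = 1 by rewrite def_u iotaE -EM mulgV E1.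
rewrite rmorphD iota_t iota_c mulrDl !mulrDr tc cc cC -mulrA tc mulr0 add0r addr0.
rewrite -ec => /addIr twt.
have: 1 + E g ^+ 3 = 0.
  have: t * t * t = E g * t.
    have Egt : E g * t = t * E g by rewrite def_t mulrDr mulrDl mulr1 mul1r.
    by rewrite -[in RHS]te -eC -twt !mulrA Egt -(mulrA t (E g)) gw mulr1.
  rewrite -mulrA -[t * (t * t)]/(t ^+ 3) exprS -[2%N]/(2 ^ 1)%N def_t add1_expr2.
  rewrite mulrDl mul1r !mulrDr !mulr1 -exprS -addrA -expr2.
  rewrite (addrA _ (E g)) [_ + E g]addrC (addrCA 1) => /(congr1 (+%R (E g + E g ^+ 2))).
  by rewrite addK addxx.
by move/add_eq0; rewrite -EX -E1 => /Einj.
Qed.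

Lemma card_complement : #|K| = 1%N \/ #|K| = 3.
Proof.
have [K1 | /trivgPn[g Kg nt_g]] := eqVneq (K : {set gT}) 1%g.
  by left; rewrite K1 cards1.
right; have nz_1g : 1 + E g != 0.
  by apply: contraNneq nt_g => /add_eq0; rewrite -E1 => /Einj <-.
have [e prim_e nz_eg] := exists_primitive_idem psi_kerN (psi1 Kg) nz_1g.
have [Ie _ ee _] := prim_e.
have eC x : e * x = x * e by apply: (ker_idem_central psi_kerN x Ie ee).
(* The truncation of h to the component e, equal to 1 on the complement. *)
pose F h := 1 + e + e * E h.
have FM h k : F h * F k = F (h * k)%g.
  rewrite /F mulrDl [(1 + e) * _]mulrDr mulrDr [e * E h * _ in X in _ + X]mulrDr mulr1.
  have c0 x : (1 + e) * (e * x) = 0 by rewrite mulrA mulrDl mul1r ee addxx mul0r.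
  rewrite c0 addr0 [_ * (1 + e)]mulrDr mulr1 mulrDl mul1r ee addxx addr0.
  rewrite -[e * E h * e]mulrA -[E h * e]eC mulrA ee addxx add0r.
  by rewrite -mulrA [E h * _]mulrA -eC -!mulrA mulrA ee EM.
have F1 : F 1%g = 1 by rewrite /F E1 mulr1 -addrA addxx addr0.
have exF h : exists k, E k == F h.
  have [||k ->] := real_unit realE (x := F h) (y := F h^-1%g); last by exists k.
    by rewrite FM mulgV F1.
  by rewrite FM mulVg F1.
have [pi piP] : exists pi, forall h, E (pi h) = F h.
  by exists (fun h => xchoose (exF h)) => h; apply/eqP/(xchooseP (exF h)).
have pi_eq h k : e * E h = e * E k -> pi h = pi k.
  by move=> ehk; apply: Einj; rewrite !piP /F ehk.
have epi h : e * E (pi h) = e * E h.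
  by rewrite piP /F !mulrDr mulr1 mulrA ee addxx add0r.
have piM : {morph pi : h k / (h * k)%g}.
  by move=> h k; apply: Einj; rewrite EM !piP FM.
have pi1 h : pi h = 1%g -> e * E h = e.
  by rewrite -epi => ->; rewrite E1 mulr1.
pose a := pi g.
have Ea : 1 + E a = e * (1 + E g).
  by rewrite piP /F -addrA addK mulrDr mulr1.
have Ka h : pi h \in K.
  apply/proj1_K/Einj; rewrite -psiE piP /F !rmorphD rmorphM rmorph1 Ie mul0r E1.
  by rewrite !addr0.
(* The part of [h] in [P] acts as 1 on [e], and for [h] in [K] the element [e * E h] is a cube root
   of unity in a field, hence the component of 1, [g] or [g ^+ 2]. *)
have pi_a h : pi h \in <[a]>%g.
  wlog Kh : h / h \in K.
    move=> IH; have -> : pi h = pi (h * (proj h)^-1)%g.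
      apply: pi_eq; rewrite EM real_commute mulrA (eC (E (proj h)^-1%g)).
      by rewrite (Sylow_fixes_ker _ Ie) ?groupV ?proj_P.
    apply: IH; apply: proj1_K.
    by rewrite projM [proj _^-1%g]proj_id ?mulgV // groupV proj_P.
  have eu k : k \in K -> e * E k = e \/ e * (1 + E k + E k ^+ 2) = 0.
    move=> Kk; have: e * (1 + E k) * (1 + E k + E k ^+ 2) = 0.
      rewrite -mulrA mulrDl mul1r [E k * _]mulrDr [E k * (1 + _)]mulrDr mulr1.
      rewrite -exprS -[E k * E k]expr2 -(EX k 3).
      by rewrite real_cube // E1 [E k + _ + 1]addrC [1 + (E k + _)]addrA addxx mulr0.
    case/(corner_domain psi_kerN prim_e) => [ek | ->]; last by right.
    by left; apply/esym/add_eq0; rewrite -{1}[e]mulr1 -mulrDr.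
  have [eh|eh] := eu h Kh.
    suff -> : pi h = 1%g by apply: group1.
    by apply: Einj; rewrite piP /F eh -addrA addxx addr0.
  have [eg | eg] := eu g Kg; first by rewrite mulrDr mulr1 eg addxx eqxx in nz_eg.
  (* The polynomial [1 + X + X ^+ 2] splits in the corner, with roots [g] and [g ^+ 2]. *)
  have: e * (E h + E g) * (E h + E g ^+ 2) = 0.
    have ew : e * (E g + E g ^+ 2) = e.
      by apply/esym/add_eq0; rewrite -{1}[e]mulr1 -mulrDr addrA.
    have -> : e * (E h + E g) * (E h + E g ^+ 2) = e * (1 + E h + E h ^+ 2); last by [].
    have hg : (E h + E g) * (E h + E g ^+ 2) = E h ^+ 2 + E h * (E g + E g ^+ 2) + 1.
      rewrite mulrDl !mulrDr (real_commute g h) -[E g * E g ^+ 2]exprS.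
      by rewrite -(EX g 3) real_cube // E1 -expr2 -!addrA [E h * E g + (_ + _)]addrCA.
    have ehw : e * (E h * (E g + E g ^+ 2)) = e * E h.
      by rewrite mulrA eC -mulrA ew.
    rewrite -mulrA hg 2!(mulrDr e) ehw (mulrDr e (1 + _)) (mulrDr e 1) mulr1.
    by rewrite [LHS]addrC [X in e + X]addrC addrA.
  case/(corner_domain psi_kerN prim_e); rewrite mulrDr => /add_eq0 ehg.
    by rewrite (pi_eq _ _ ehg) cycle_id.
  rewrite -EX in ehg; rewrite (pi_eq _ _ ehg).
  by rewrite expgS piM groupM ?cycle_id.
have nt_a : a != 1%g.
  by apply: contraNneq nz_eg => a1; rewrite -Ea a1 E1 addxx.
have oa : #[a]%g = 3 by apply: nt_prime_order => //; apply: real_cube (Ka g).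
suff -> : K = <[a]>%G by rewrite -oa.
apply/group_inj/eqP; rewrite eqEsubset /= cycle_subG Ka andbT; apply/subsetP=> b' Kb'.
(* Dividing by [pi b'] makes the component of [b] at [e] trivial. *)
pose b : gT := (b' * (pi b')^-1)%g.
have pi_pi h : pi (pi h) = pi h by apply: pi_eq.
have pib : pi b = 1%g.
  by apply: (mulIg (pi (pi b'))); rewrite -piM mulgKV mul1g pi_pi.
have Kb : b \in K by rewrite groupM ?groupV.
suff b1 : b = 1%g by rewrite -(mulgKV (pi b') b') -/b b1 mul1g.
have ob : (#[b]%g %| #[a]%g)%N by rewrite oa order_dvdn real_cube ?eqxx.
(* [eltm ob] is the morphism on [<[a]>] sending [a] to [b]; hence [phi] lifts an endomorphism with
   [a |-> b * a] and [b |-> b]. *)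
have [phi phiE] : exists phi : {rmorphism S -> S},
    forall h, phi (E h) = E (eltm ob (pi h) * h)%g.
  apply: (real_lift_fun realE) => h k /=.
  by rewrite piM eltmM // -!mulgA; congr (_ * _)%g; rewrite !mulgA (real_abelian h).
have ab0 : (1 + E a) * (1 + E b) = 0.
  by rewrite Ea eC -mulrA mulrDr mulr1 pi1 // addxx mulr0.
have: phi ((1 + E a) * (1 + E b)) = 0 by rewrite ab0 rmorph0.
rewrite rmorphM !rmorphD rmorph1 !phiE pib pi_pi eltm_id morph1 mul1g EM.
(* By [ab0] only the square of [1 + E b] survives in the product, and reducedness of the kernel then
   forces [b = 1]. *)
have -> : 1 + E b * E a = (1 + E b) + E b * (1 + E a).
  by rewrite mulrDr mulr1 -addrA addK.
rewrite mulrDl -mulrA ab0 mulr0 addr0 => /(psi_kerN (psi1 Kb))/add_eq0.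
by rewrite -E1 => /Einj.
Qed.

End FiniteRealization.

(** * Necessity: only four cyclic groups remain *)

Lemma fully_realizable_cyclic (gT : finGroupType) (P : {group gT}) :
    (2.-Sylow([set: gT]) P)%g -> cyclic P -> (P :!=: 1)%g ->
    fully_realizable gT ->
  cyclic [set: gT] /\
  exists2 q, q \in [:: 1; 3]%N & #|[set: gT]| = (q * #|P|)%N /\ (#|P| <= 4)%N.
Proof.
move=> sylP cycP ntP /fully_realizableP[R [E0 /finite_realization[S [E realE]]]].
have [K defG oddK] := cyclic_Sylow2_complement sylP cycP ntP.
have [nKG _ _ _ _] := sdprod_context defG.
have pP : (2.-group P)%g by have [] := and3P sylP.
have [g h|psi psiE] := real_lift_fun realE (f := remgr K P).
  by apply: (remgrM (sdprod_compl defG) nKG); rewrite inE.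
have abG := real_abelian realE defG oddK cycP psiE.
have defGx : (K \x P)%g = [set: gT].
  by rewrite dprodEsd //; apply/centsP=> x _ y _; apply: abG.
have cardK := card_complement realE defG oddK pP cycP psiE.
have cycK : cyclic K.
  case: cardK => [/card1_trivg-> | K3]; first exact: cyclic1.
  by apply: prime_cyclic; rewrite K3.
split.
  rewrite (cyclic_dprod defGx cycK cycP) coprime_sym.
  by have [k ->] := p_natP pP; rewrite coprimeXl // coprime2n.
exists #|K|; first by case: cardK => ->.
by rewrite (sdprod_card defG) (card_Sylow_le4 realE defG pP cycP psiE).
Qed.

Lemma Zp_cyclic n : cyclic (Zp n).
Proof.
rewrite /Zp; case: ifP => _; last exact: cyclic1.
by rewrite Zp_cycle cycle_cyclic.
Qed.

Lemma fully_realizable_isog (gT : finGroupType)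
    (even_gT : (2 %| #|[set: gT]|)%N)
    (cycSyl2 : (exists P : {group gT}, 2.-Sylow([set: gT]) P && cyclic P)%g) :
  fully_realizable gT ->
  [\/ ([set: gT] \isog Zp 2)%g, ([set: gT] \isog Zp 6)%g,
      ([set: gT] \isog Zp 4)%g | ([set: gT] \isog Zp 12)%g].
Proof.
have [P /andP[sylP cycP]] := cycSyl2.
have evenP : (2 %| #|P|)%N.
  have [sPG _ p'GP] := and3P sylP.
  by move: even_gT; rewrite -(Lagrange sPG) Gauss_dvdl // coprime2n odd_2'nat.
have ntP : (P :!=: 1)%g by apply: contraTneq evenP => ->; rewrite cards1.
case/(fully_realizable_cyclic sylP cycP ntP) => cycG [q q13 [cardG le4]].
have isogZp n : (1 < n)%N -> #|[set: gT]| = n -> ([set: gT] \isog Zp n)%g.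
  move=> n_gt1 Gn; rewrite isog_cyclic_card // card_Zp 1?ltnW // Gn eqxx andbT.
  exact: Zp_cyclic.
have P24 : #|P| \in [:: 2; 4]%N.
  by move: #|P| le4 evenP (cardG_gt0 P) => [|[|[|[|[|]]]]].
move: q13 P24; rewrite !inE => /orP[]/eqP qE /orP[]/eqP PE; rewrite qE PE in cardG.
- by apply: Or41; apply: isogZp.
- by apply: Or43; apply: isogZp.
- by apply: Or42; apply: isogZp.
- by apply: Or44; apply: isogZp.
Qed.

(** * Sufficiency: rings with a cyclic group of units *)

Record cyclic_realization (R : pzRingType) (u : R) (n : nat) : Prop := {
  creal_exp : u ^+ n = 1;
  creal_order : forall i, u ^+ i = 1 -> (n %| i)%N;
  creal_unit : forall x y, x * y = 1 -> y * x = 1 -> exists i, x = u ^+ i;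
  creal_lift : forall m, exists psi : {rmorphism R -> R}, psi u = u ^+ m
}.

Lemma creal_modn (R : pzRingType) (u : R) n i :
  cyclic_realization u n -> u ^+ (i %% n) = u ^+ i.
Proof. by case=> un _ _ _; apply: expr_mod. Qed.

(** An endomorphism of a cyclic group is a power map, so lifting it only requires
    [psi u = u ^+ m]. *)
Lemma cyclic_fully_realizable (gT : finGroupType) (R : pzRingType) (u : R) n :
    (0 < n)%N -> cyclic_realization u n -> ([set: gT] \isog Zp n)%g ->
  fully_realizable gT.
Proof.
move=> n_gt0 real_u isoG; apply/fully_realizableP.
have cycG : cyclic [set: gT] by rewrite (isog_cyclic isoG) Zp_cyclic.
have /cyclicP[g defG] := cycG.
have og : #[g]%g = n by rewrite /order -defG (card_isog isoG) card_Zp.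
have [un ord_u unit_u lift_u] := real_u.
have eq_exp i j : (u ^+ i == u ^+ j) = (g ^+ i == g ^+ j)%g.
  rewrite eq_expg_mod_order og; apply/eqP/eqP=> [uij | ij]; last first.
    by rewrite -(creal_modn i real_u) ij creal_modn.
  (* [i * n.-1] is an exponent for the inverse of [u ^+ i]. *)
  have nij : (i + i * n.-1 = 0 %[mod n])%N by rewrite -mulnS prednK // modnMl mod0n.
  apply/eqP; rewrite -(eqn_modDr (i * n.-1)) nij mod0n eq_sym; apply: ord_u.
  by rewrite exprD -uij -exprD -mulnS prednK // mulnC exprM un expr1n.
have logP x : exists i, (g ^+ i == x)%g.
  have : x \in <[g]>%g by rewrite -defG inE.
  by case/cycleP=> i ->; exists i.
pose E x := u ^+ (xchoose (logP x)).
have EX i : E (g ^+ i)%g = u ^+ i.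
  by apply/eqP; rewrite eq_exp; apply: (xchooseP (logP _)).
have powg x : exists i, x = (g ^+ i)%g by have [i /eqP <-] := logP x; exists i.
exists R, E; split.
- by rewrite -(expg0 g) EX.
- by move=> x y; have [i ->] := powg x; have [j ->] := powg y; rewrite -expgD !EX exprD.
- move=> x y; have [i ->] := powg x; have [j ->] := powg y.
  by rewrite !EX => /eqP; rewrite eq_exp => /eqP.
- by move=> x y xy yx; have [i ->] := unit_u x y xy yx; exists (g ^+ i)%g.
move=> f; have [m fg] := powg (f g); have [psi psiu] := lift_u m.
exists psi => x; have [i ->] := powg x.
have f1 : f 1%g = 1%g by apply: (mulgI (f 1%g)); rewrite -gmulfM !mulg1.
have -> : f (g ^+ i)%g = (f g ^+ i)%g.
  by elim: i => [|i IHi]; rewrite ?expg0 // !expgS gmulfM IHi.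
by rewrite EX rmorphXn /= psiu fg -expgM EX exprM.
Qed.

(* F_2[x]/(x^2 + b x + a), with (c, d) standing for c + d x: this is F_4 for
   a = b = 1 and the ring of dual numbers for a = b = 0. *)
Definition quadratic (a b : bool) : Type := (bool * bool)%type.
HB.instance Definition _ a b := GRing.Zmodule.copy (quadratic a b) (bool * bool)%type.

Definition quad_mul a b (x y : quadratic a b) : quadratic a b :=
  ((x.1 && y.1) (+) [&& a, x.2 & y.2],
   (x.1 && y.2) (+) (x.2 && y.1) (+) [&& b, x.2 & y.2]).
Definition quad_one a b : quadratic a b := (true, false).

Fact quad_mulA a b : associative (@quad_mul a b).
Proof. by move: a b => [] [] [[] []] [[] []] [[] []]. Qed.
Fact quad_mul1 a b : left_id (quad_one a b) (@quad_mul a b).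
Proof. by move: a b => [] [] [[] []]. Qed.
Fact quad_1mul a b : right_id (quad_one a b) (@quad_mul a b).
Proof. by move: a b => [] [] [[] []]. Qed.
Fact quad_mulDl a b : left_distributive (@quad_mul a b) +%R.
Proof. by move: a b => [] [] [[] []] [[] []] [[] []]. Qed.
Fact quad_mulDr a b : right_distributive (@quad_mul a b) +%R.
Proof. by move: a b => [] [] [[] []] [[] []] [[] []]. Qed.

HB.instance Definition _ a b := GRing.Zmodule_isPzRing.Build (quadratic a b)
  (@quad_mulA a b) (@quad_mul1 a b) (@quad_1mul a b)
  (@quad_mulDl a b) (@quad_mulDr a b).

Local Notation F4 := (quadratic true true).
Local Notation dual_numbers := (quadratic false false).

Definition F4gen : F4 := (false, true).

(** Squaring replaces [x] by [x^2 = 1 + x]. *)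
Definition frobenius (x : F4) : F4 := (x.1 (+) x.2, x.2).
Fact frobenius_zmod : zmod_morphism frobenius.
Proof. by case=> [[] []] [[] []]. Qed.
Fact frobenius_monoid : monoid_morphism frobenius.
Proof. by split=> //; case=> [[] []] [[] []]. Qed.
HB.instance Definition _ :=
  GRing.isZmodMorphism.Build F4 F4 frobenius frobenius_zmod.
HB.instance Definition _ :=
  GRing.isMonoidMorphism.Build F4 F4 frobenius frobenius_monoid.

Lemma F4_unit (x y : F4) : x * y = 1 -> exists i, x = F4gen ^+ i.
Proof.
by case: x y => [[] []] [[] []] // _; by [exists 0%N | exists 1%N | exists 2%N].
Qed.

Lemma F4gen_modn i : F4gen ^+ (i %% 3) = F4gen ^+ i.
Proof. exact: expr_mod. Qed.

Lemma F4gen_order i : F4gen ^+ i = 1 -> (3 %| i)%N.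
Proof.
rewrite -F4gen_modn /dvdn.
by case: (i %% 3)%N (ltn_pmod i (isT : (0 < 3)%N)) => [|[|[|]]].
Qed.

(** The Chinese remainder theorem combines the two unit groups. No endomorphism of the field F_4
    sends [F4gen] to 1, so power maps that are trivial on the factor of order 3 are lifted through
    [pi] on the second factor. *)
Lemma F4_product (B : pzRingType) (u : B) n (pi : {rmorphism B -> F4}) :
    coprime 3 n -> cyclic_realization u n -> pi u = 1 ->
  cyclic_realization ((F4gen, u) : (F4 * B)%type) (3 * n).
Proof.
move=> co3n real_u pi_u; have [un ord_u unit_u lift_u] := real_u.
have pairX i : ((F4gen, u) : (F4 * B)%type) ^+ i = (F4gen ^+ i, u ^+ i).
  by elim: i => // i IHi; rewrite exprS IHi !exprS.
split.
- by rewrite pairX exprM expr1n mulnC exprM un expr1n.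
- move=> i; rewrite pairX => -[wi ui]; rewrite Gauss_dvd //.
  by rewrite F4gen_order // ord_u.
- move=> [x1 x2] [y1 y2] xy yx.
  have [i x1i] := F4_unit (congr1 fst xy : x1 * y1 = 1).
  have [j x2j] := unit_u x2 y2 (congr1 snd xy) (congr1 snd yx).
  exists (chinese 3 n i j); rewrite pairX x1i x2j; congr (_, _).
    by rewrite -(F4gen_modn (chinese 3 n i j)) chinese_modl // F4gen_modn.
  by rewrite -(creal_modn (chinese 3 n i j) real_u) chinese_modr // creal_modn.
move=> m; have [g gu] := lift_u m.
have [f fE] : exists f : {rmorphism F4 * B -> F4}, f (F4gen, u) = F4gen ^+ m.
  rewrite -(F4gen_modn m).
  case: (m %% 3)%N (ltn_pmod m (isT : (0 < 3)%N)) => [|[|[|]]] // _.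
  - by exists (pi \o snd).
  - by exists fst.
  - by exists (frobenius \o fst).
pose h x := (f x, g x.2).
have hB : zmod_morphism h by move=> x y; rewrite /h !rmorphB.
have hM : monoid_morphism h.
  by split=> [|x y]; rewrite /h ?rmorph1 ?rmorphM.
pose h_zmod := GRing.isZmodMorphism.Build (F4 * B)%type (F4 * B)%type h hB.
pose h_mon := GRing.isMonoidMorphism.Build (F4 * B)%type (F4 * B)%type h hM.
pose H : {rmorphism F4 * B -> F4 * B} := HB.pack h h_zmod h_mon.
by exists H; rewrite pairX -fE -gu.
Qed.

Definition dual_gen : dual_numbers := (true, true).

Lemma dual_numbers_real : cyclic_realization dual_gen 2.
Proof.
have u_modn i : dual_gen ^+ (i %% 2) = dual_gen ^+ i.
  exact: expr_mod.
split=> // [i | x y | m].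
- rewrite -u_modn /dvdn.
  by case: (i %% 2)%N (ltn_pmod i (isT : (0 < 2)%N)) => [|[|]].
- by case: x y => [[] []] [[] []] // _ _; by [exists 0%N | exists 1%N].
rewrite -u_modn.
case: (m %% 2)%N (ltn_pmod m (isT : (0 < 2)%N)) => [|[|]] // _; last by exists idfun.
(* Setting the nilpotent variable to 0 sends the generator [1 + x] to 1. *)
pose h (x : dual_numbers) : dual_numbers := (x.1, false).
have hB : zmod_morphism h by move=> [[] []] [[] []].
have hM : monoid_morphism h by split=> //; case=> [[] []] [[] []].
pose h_zmod := GRing.isZmodMorphism.Build _ _ h hB.
pose h_mon := GRing.isMonoidMorphism.Build _ _ h hM.
by exists (HB.pack_for {rmorphism dual_numbers -> dual_numbers} h h_zmod h_mon).
Qed.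

(* F_2[x]/(x^3), with (c, d, e) standing for c + d x + e x^2. *)
Definition trunc3 : Type := (bool * bool * bool)%type.
HB.instance Definition _ := GRing.Zmodule.copy trunc3 (bool * bool * bool)%type.

Definition trunc3_mul (x y : trunc3) : trunc3 :=
  (x.1.1 && y.1.1, (x.1.1 && y.1.2) (+) (x.1.2 && y.1.1),
   (x.1.1 && y.2) (+) (x.1.2 && y.1.2) (+) (x.2 && y.1.1)).
Definition trunc3_one : trunc3 := (true, false, false).
Fact trunc3_mulA : associative trunc3_mul.
Proof. by move=> [[[] []] []] [[[] []] []] [[[] []] []]. Qed.
Fact trunc3_mul1 : left_id trunc3_one trunc3_mul.
Proof. by move=> [[[] []] []]. Qed.
Fact trunc3_1mul : right_id trunc3_one trunc3_mul.
Proof. by move=> [[[] []] []]. Qed.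
Fact trunc3_mulDl : left_distributive trunc3_mul +%R.
Proof. by move=> [[[] []] []] [[[] []] []] [[[] []] []]. Qed.
Fact trunc3_mulDr : right_distributive trunc3_mul +%R.
Proof. by move=> [[[] []] []] [[[] []] []] [[[] []] []]. Qed.

HB.instance Definition _ := GRing.Zmodule_isPzRing.Build trunc3
  trunc3_mulA trunc3_mul1 trunc3_1mul trunc3_mulDl trunc3_mulDr.

(* The substitution of c x + d x^2 for x. *)
Definition trunc3_subst c d (x : trunc3) : trunc3 :=
  (x.1.1, x.1.2 && c, (x.1.2 && d) (+) (x.2 && c)).
Fact trunc3_subst_zmod c d : zmod_morphism (trunc3_subst c d).
Proof. by move: c d => [] [] [[[] []] []] [[[] []] []]. Qed.
Fact trunc3_subst_monoid c d : monoid_morphism (trunc3_subst c d).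
Proof. by split; move: c d => [] [] //; move=> [[[] []] []] [[[] []] []]. Qed.
HB.instance Definition _ c d :=
  GRing.isZmodMorphism.Build trunc3 trunc3 (trunc3_subst c d) (trunc3_subst_zmod c d).
HB.instance Definition _ c d :=
  GRing.isMonoidMorphism.Build trunc3 trunc3 (trunc3_subst c d)
    (trunc3_subst_monoid c d).

Definition trunc3_gen : trunc3 := (true, true, false).

(** The powers of [1 + x] are 1, [1 + x], [1 + x^2] and [1 + x + x^2]; the [m]-th power map lifts to
    the substitution of [(1 + x)^m - 1] for [x]. *)
Lemma trunc3_real : cyclic_realization trunc3_gen 4.
Proof.
have u_modn i : trunc3_gen ^+ (i %% 4) = trunc3_gen ^+ i.
  exact: expr_mod.
split=> // [i | x y | m].
- rewrite -u_modn /dvdn.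
  by case: (i %% 4)%N (ltn_pmod i (isT : (0 < 4)%N)) => [|[|[|[|]]]].
- by case: x y => [[[] []] []] [[[] []] []] // _ _;
    by [exists 0%N | exists 1%N | exists 2%N | exists 3%N].
rewrite -u_modn.
case: (m %% 4)%N (ltn_pmod m (isT : (0 < 4)%N)) => [|[|[|[|]]]] // _.
- by exists (trunc3_subst false false).
- by exists (trunc3_subst true false).
- by exists (trunc3_subst false true).
- by exists (trunc3_subst true true).
Qed.

(** Reduction to the residue field F_2, embedded in F_4; it serves as [pi] in [F4_product]. *)
Definition dual_residue (x : dual_numbers) : F4 := (x.1, false).
Fact dual_residue_zmod : zmod_morphism dual_residue.
Proof. by move=> [[] []] [[] []]. Qed.
Fact dual_residue_monoid : monoid_morphism dual_residue.
Proof. by split=> //; case=> [[] []] [[] []]. Qed.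
HB.instance Definition _ :=
  GRing.isZmodMorphism.Build dual_numbers F4 dual_residue dual_residue_zmod.
HB.instance Definition _ :=
  GRing.isMonoidMorphism.Build dual_numbers F4 dual_residue dual_residue_monoid.

Definition trunc3_residue (x : trunc3) : F4 := (x.1.1, false).
Fact trunc3_residue_zmod : zmod_morphism trunc3_residue.
Proof. by move=> [[[] []] []] [[[] []] []]. Qed.
Fact trunc3_residue_monoid : monoid_morphism trunc3_residue.
Proof. by split=> //; case=> [[[] []] []] [[[] []] []]. Qed.
HB.instance Definition _ :=
  GRing.isZmodMorphism.Build trunc3 F4 trunc3_residue trunc3_residue_zmod.
HB.instance Definition _ :=
  GRing.isMonoidMorphism.Build trunc3 F4 trunc3_residue trunc3_residue_monoid.

Local Close Scope ring_scope.

Theorem theorem9p6 (gT : finGroupType)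
    (even_gT : 2 %| #|[set: gT]|)
    (cycSyl2 : (exists P : {group gT}, 2.-Sylow([set: gT]) P && cyclic P)%g) :
  fully_realizable gT <->
  [\/ ([set: gT] \isog Zp 2)%g, ([set: gT] \isog Zp 6)%g,
      ([set: gT] \isog Zp 4)%g | ([set: gT] \isog Zp 12)%g].
Proof.
split; first exact: fully_realizable_isog.
case=> isoG.
- exact: (cyclic_fully_realizable _ dual_numbers_real isoG).
- have real6 := @F4_product _ _ 2 dual_residue isT dual_numbers_real erefl.
  exact: (cyclic_fully_realizable _ real6 isoG).
- exact: (cyclic_fully_realizable _ trunc3_real isoG).
- have real12 := @F4_product _ _ 4 trunc3_residue isT trunc3_real erefl.
  exact: (cyclic_fully_realizable _ real12 isoG).
Qed.
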